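(* Assume countable additivity (as defined in the context). Let $X_1,X_2,\dots$ be variables, not necessarily bounded, such that $X_1,\dots,X_n$ satisfy weak irrelevance (as defined in the context) for every $n$. Suppose that $\underline{E}[X_i]$ and $\overline{E}[X_i]$ are finite for every $i$, that there is a finite $\delta$ with $\overline{E}[X_i]-\underline{E}[X_i]\le\delta$ for every $i$, and that there is a finite $\sigma^2$ such that the variance of every $X_i$ (under every $P\in\mathcal{K}$) is no larger than $\sigma^2$. Let $\underline{\mu}_n=\frac1n\sum_{i=1}^n\underline{E}[X_i]$ and $\overline{\mu}_n=\frac1n\sum_{i=1}^n\overline{E}[X_i]$. Then for any $\epsilon>0$ and every positive integer $n$, $$\underline{P}\Big(\underline{\mu}_n-\epsilon<\frac{\sum_{i=1}^nX_i}{n}<\overline{\mu}_n+\epsilon\Big)\ge1-\frac{\sigma^2+\delta^2}{\epsilon^2n},$$ and for any $\epsilon>0$ there is a positive integer $N$ such that for any positive integer $N'$, $$\underline{P}\Big(\forall n\in[N,N+N']:\ \underline{\mu}_n-\epsilon<\frac{\sum_{i=1}^nX_i}{n}<\overline{\mu}_n+\epsilon\Big)>1-2\epsilon.$$ Consequently, $$\forall\epsilon>0:\ \lim_{n\to\infty}\underline{P}\Big(\underline{\mu}_n-\epsilon<\frac{\sum_{i=1}^nX_i}{n}<\overline{\mu}_n+\epsilon\Big)=1,$$ $$\underline{P}\Big(\limsup_{n\to\infty}\Big(\frac{\sum_{i=1}^nX_i}{n}-\overline{\mu}_n\Big)\le0\Big)=1,$$ $$\underline{P}\Big(\liminf_{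n\to\infty}\Big(\frac{\sum_{i=1}^nX_i}{n}-\underline{\mu}_n\Big)\ge0\Big)=1.$$
   Context: A nonempty set $\mathcal{K}$ of probability measures on a common measurable space $\Omega$ is fixed; variables are real-valued measurable functions, events are measurable sets and are identified with their indicator functions. Countable additivity: for every $P\in\mathcal{K}$, if $A_1\supset A_2\supset\cdots$ is a sequence of events with $\bigcap_iA_i=\emptyset$ then $\lim_{n\to\infty}P(A_n)=0$. Thus each $P$ is an ordinary probability measure, $E_P$ is the Lebesgue integral, and $E_P[W]=E_P[E_P[W|Z]]$ holds for each $P$. Lower and upper expectations are $\underline{E}[X]=\inf_{P\in\mathcal{K}}E_P[X]$ and $\overline{E}[X]=\sup_{P\in\mathcal{K}}E_P[X]$; lower and upper probabilities are $\underline{P}(A)=\inf_{P\in\mathcal{K}}P(A)$ and $\overline{P}(A)=\sup_{P\in\mathcal{K}}P(A)$. In $[N,N+N']$, $n$ ranges over integers. Notation: $X_{1:k}$ stands for $X_1,\dots,X_k$, and $A(X_{1:k})$ denotes an event defined by $X_{1:k}$, i.e. of the form $\{(X_1,\dots,X_k)\in S\}$. Conditioning is elementwise: given an event $A$, each $P\in\mathcal{K}$ has a conditional expectation functional $E_P[\cdot|A]$ with $E_P[X|A]P(A)=E_P[XA]$, and $\underline{E}[X|A]$, $\overline{E}[X|A]$ are the infimum and supremum of the resulting $E_P[X|A]$. There are two set-ups. (I) Full conditional measures: for each $P\in\mathcal{K}$, $E_P[\cdot|A]$ is defined for every nonempty $A$, it is the expectation functional of $P(\cdot|A)$, and $P(\cdot|\cdot)$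 satisfies, for nonempty conditioning events, $P(C|C)=1$; $P(A|C)\ge0$; $P(A\cup B|C)=P(A|C)+P(B|C)$ for disjoint $A,B$; $P(A\cap B|C)=P(A|B\cap C)P(B|C)$ if $B\cap C\ne\emptyset$; with $P(\cdot|\Omega)=P$. (II) $E_P[\cdot|A]$ is defined only when $P(A)>0$; then $\underline{E}[X|A]$ and $\overline{E}[X|A]$ are the infimum and supremum over those $P\in\mathcal{K}$ with $P(A)>0$, and are defined when $\overline{P}(A)>0$. Weak irrelevance of $X_1,\dots,X_n$ means that at least one of the following holds: (W1) in set-up (I), for any $i\in\{2,\dots,n\}$ and any nonempty event $A(X_{1:i-1})$, $\underline{E}[X_i|A(X_{1:i-1})]=\underline{E}[X_i]$ and $\overline{E}[X_i|A(X_{1:i-1})]=\overline{E}[X_i]$; (W2) in set-up (II), for any $i\in\{2,\dots,n\}$ and any event $A(X_{1:i-1})$ with $\overline{P}(A(X_{1:i-1}))>0$, the same two equalities hold. *)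

(* Defs.v *)
From HB Require Import structures.
From mathcomp Require Import all_boot all_order all_algebra.
From mathcomp Require Import all_classical all_reals all_analysis.
Set Implicit Arguments.
Unset Strict Implicit.
Unset Printing Implicit Defensive.
Import Order.TTheory GRing.Theory Num.Theory.
Import numFieldNormedType.Exports.
Local Open Scope classical_set_scope.
Local Open Scope ring_scope.
Local Open Scope ereal_scope.

Section lower_upper.
Context {d : measure_display} {T : measurableType d} {R : realType}.
Implicit Types (K : set (probability T R)) (X : T -> R) (A : set T).

(* If the integrals of the positive and of the negative part of X are both
   infinite, then 'E_P[X] = +oo - +oo = -oo, and the lower expectation is -oo:
   finiteness of both lowerE K X and upperE K X therefore entails that X is
   P-integrable for every P in K. *)
Definition lowerE K X : \bar R := ereal_inf [set 'E_P[X] | P in K].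

Definition upperE K X : \bar R := ereal_sup [set 'E_P[X] | P in K].

Definition lowerP K A : \bar R := ereal_inf [set P A | P in K].

Definition upperP K A : \bar R := ereal_sup [set P A | P in K].

(* [c A C] stands for P(A|C). Nothing beyond finite additivity is required of
   c(.|C) when P(C) = 0. *)
Record full_conditional (P : probability T R) (c : set T -> set T -> R) :
    Prop := FullConditional {
  full_cond_id : forall C, measurable C -> C !=set0 -> c C C = 1%R ;
  full_cond_ge0 : forall A C, measurable A -> measurable C -> C !=set0 ->
    (0 <= c A C)%R ;
  full_cond_add : forall A B C,
    measurable A -> measurable B -> measurable C -> C !=set0 ->
    A `&` B = set0 -> c (A `|` B) C = (c A C + c B C)%R ;
  full_cond_mul : forall A B C,
    measurable A -> measurable B -> measurable C -> B `&` C !=set0 ->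
    c (A `&` B) C = (c A (B `&` C) * c B C)%R ;
  full_cond_setT : forall A, measurable A -> (c A setT)%:E = P A }.

(* The set function c(.|C) need not be a measure; [integral] accepts any set
   function. For a finitely additive c(.|C) the integral of a nonnegative
   measurable X is the supremum of the integrals of the simple functions below
   X, that is, the Dunford integral; it is the Lebesgue integral when c(.|C)
   is countably additive. *)
Definition full_condE (c : set T -> set T -> R) X C : \bar R :=
  \int[fun A => (c A C)%:E]_w (X w)%:E.

(* Meaningful for 0 < P A. *)
Definition condE (P : probability T R) X A : \bar R :=
  'E_P[X \* \1_A] * ((fine (P A))^-1)%:E.

Definition past_event (X : nat -> T -> R) (i : nat) A :=
  measurable A /\
  exists S : set 'rV[R]_i, A = [set w | S (\row_(j < i) X j w)].

(* Random variables are numbered from 0, so that the ones preceding [X i] are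
   [X 0], ..., [X i.-1]. *)
Definition weak_irrelevance_full K
    (c : probability T R -> set T -> set T -> R) (X : nat -> T -> R)
    (n : nat) :=
  (forall P, K P -> full_conditional P (c P)) /\
  forall i A, (0 < i < n)%N -> past_event X i A -> A !=set0 ->
    ereal_inf [set full_condE (c P) (X i) A | P in K] = lowerE K (X i) /\
    ereal_sup [set full_condE (c P) (X i) A | P in K] = upperE K (X i).

Definition weak_irrelevance_pos K (X : nat -> T -> R) (n : nat) :=
  forall i A, (0 < i < n)%N -> past_event X i A -> 0 < upperP K A ->
    ereal_inf [set condE P (X i) A | P in K `&` [set P | 0 < P A]]
      = lowerE K (X i) /\
    ereal_sup [set condE P (X i) A | P in K `&` [set P | 0 < P A]]
      = upperE K (X i).

Definition weak_irrelevance K c (X : nat -> T -> R) (n : nat) :=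
  weak_irrelevance_full K c X n \/ weak_irrelevance_pos K X n.

Definition mean_lowerE K (X : nat -> T -> R) (n : nat) : R :=
  ((\sum_(i < n) fine (lowerE K (X i))) / n%:R)%R.

Definition mean_upperE K (X : nat -> T -> R) (n : nat) : R :=
  ((\sum_(i < n) fine (upperE K (X i))) / n%:R)%R.

Definition sample_mean (X : nat -> T -> R) (n : nat) (w : T) : R :=
  ((\sum_(i < n) X i w) / n%:R)%R.

End lower_upper.

(* Main.v *)
Require Import Defs.
From HB Require Import structures.
From mathcomp Require Import all_boot all_order all_algebra.
From mathcomp Require Import all_classical all_reals all_analysis.
From mathcomp Require Import measurable_realfun ring lra.
Import Order.TTheory GRing.Theory Num.Theory.
Import numFieldNormedType.Exports.
Local Open Scope classical_set_scope.
Local Open Scope ring_scope.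
Local Open Scope ereal_scope.

(** Fix P in K. Both forms of irrelevance, applied to events A of positive
    P-probability that are determined by X_0, ..., X_{i-1}, give
      l_i P(A) <= E_P[X_i 1_A] <= u_i P(A),
    where l_i and u_i are the lower and upper expectations of X_i
    ([past_integral_bounds]): in the full conditional set-up, P(.|A) is
    P(. `&` A)/P(A) as soon as P(A) > 0 ([full_condE_pos]). These inequalities
    stand in for bounds on the conditional expectation of X_i given the past.

    The partial sums are compared with a feedback process: V_0 = 0 and
    V_{n+1} = V_n + X_n - t_n, where t_n is u_n when V_n > 0 and l_n otherwise
    ([excess]). As every t_n lies between l_n and u_n, the sum of the X_i
    minus V_n lies between the sums of the l_i and of the u_i, so that the
    sample mean is inside the band of half-width eps around the means of the
    l_i and u_i as soon as |V_n| < eps n.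

    The process V is pushed towards 0: the cross term V_n (X_n - t_n) has
    nonpositive integral over every event J of the past. It is a product of
    V_n, whose sign is known on each side of 0, by a variable whose integral
    has the opposite sign on every event of the past, and approximation by
    simple functions of V_n concludes ([Rintegral_mul_le0]). As for
    (X_n - t_n)^2, expanding it around m = E_P[X_n] leaves the variance plus
    at most (u_n - l_n)^2. Hence ([drift_sqr_le])
      E_P[V_{n+1}^2 1_J] <= E_P[V_n^2 1_J] + C,  C = sigma^2 + delta^2.

    A nonnegative process with such a drift satisfies an inequality of
    Hajek-Renyi type ([maximal_inequality]):
      P(V_n^2 >= eps^2 n^2 for some n in [N, N+m])
        <= C (2/N - 1/(N+m)) / eps^2.
    The case m = 0 is the first bound of the theorem, the general case is the
    second one because the right-hand side is at most 2C / (N eps^2) whatever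
    m is, and letting m and then N tend to infinity shows that V_n / n tends
    to 0 P-almost surely ([ae_excess_lt]), hence the last two claims. No
    constant depends on P, so the bounds pass to the infimum over K. *)

Set Implicit Arguments.
Unset Strict Implicit.
Unset Printing Implicit Defensive.

(** * Conditioning on an event of positive probability *)

Section conditioning.
Import HBNNSimple.
Context {d : measure_display} {T : measurableType d} {R : realType}.
Implicit Types (P : probability T R) (X : T -> R) (A : set T).

(** The set functions need not be measures: the integral only tests them on the
    level sets of simple functions. This gives access to [P(.|A)], about which
    nothing is known on nonmeasurable sets. *)
Lemma integral_eq_on_measurable (m1 m2 : set T -> \bar R) (f : T -> \bar R) :
  (forall A, measurable A -> m1 A = m2 A) ->
  \int[m1]_x f x = \int[m2]_x f x.
Proof.
move=> m12.
have E (h : {nnsfun T >-> R}) : sintegral m1 h = sintegral m2 h.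
  by apply: eq_fsbigr => x _; rewrite m12.
rewrite /integral; congr (ereal_sup _ - ereal_sup _);
  by apply: eq_imagel => h _; exact: E.
Qed.

Lemma ge0_integral_mrestr (mu : {measure set T -> \bar R}) A
    (mA : measurable A) (f : T -> \bar R) :
  measurable_fun [set: T] f -> (forall x, 0 <= f x) ->
  \int[mrestr mu mA]_x f x = \int[mu]_(x in A) f x.
Proof.
move=> mf f0.
have mAC := measurableC mA.
rewrite -(setUv A) ge0_integral_setU//; last 2 first.
- by rewrite setUv.
- by apply/disj_set2P; rewrite setICr.
rewrite (eq_measure_integral mu) => [|B mB BA]; last first.
  by rewrite /= /mrestr setIidl.
rewrite [X in _ + X]null_set_integral ?adde0//.
- exact: measurable_funTS.
- by rewrite /= /mrestr setICl measure0.
Qed.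

Lemma condE_integrable P X A : P.-integrable setT (EFin \o X) -> measurable A ->
  condE P X A = (\int[P]_(x in A) X x / fine (P A))%:E.
Proof.
move=> iX mA; rewrite /condE unlock EFinM; congr (_ * _).
rewrite fineK; last first.
  by apply: integrable_fin_num => //; exact: integrableS iX.
rewrite [RHS]integral_mkcond; apply: eq_integral => x _ /=.
by rewrite patchE indicE; case: ifPn; rewrite ?mulr1 ?mulr0.
Qed.

(** The product rule P(B `&` A | T) = P(B | A) P(A | T) determines P(B | A)
    once P(A) > 0, so that the two set-ups agree on such events. *)
Lemma full_condE_pos P c X A : full_conditional P c ->
  P.-integrable setT (EFin \o X) -> measurable A -> 0 < P A ->
  full_condE c X A = condE P X A.
Proof.
move=> fc iX mA PA0; rewrite condE_integrable//.
have PAfin : P A \is a fin_num by exact: fin_num_measure.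
have fPA0 : (0 < fine (P A))%R by rewrite fine_gt0// PA0 ltey_eq PAfin.
have A0 : A !=set0.
  by apply/set0P; apply: contraTneq PA0 => ->; rewrite measure0 ltxx.
have k0 : (0 <= (fine (P A))^-1)%R by rewrite invr_ge0 ltW.
pose k := NngNum k0.
rewrite /full_condE (@integral_eq_on_measurable _ (mscale k (mrestr P mA))).
  have iXA : P.-integrable A (EFin \o X) by exact: integrableS iX.
  have mX : measurable_fun [set: T] (EFin \o X) by exact: (measurable_int P).
  have fp := integrable_pos_fin_num mA iXA.
  have fn := integrable_neg_fin_num mA iXA.
  rewrite integralE !ge0_integral_mscale//; last 2 first.
  - exact: measurable_funeneg.
  - exact: measurable_funepos.
  rewrite !ge0_integral_mrestr//; last 2 first.
  - exact: measurable_funeneg.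
  - exact: measurable_funepos.
  rewrite -muleBr//; last by rewrite fin_num_adde_defr.
  rewrite mulrC EFinM; congr (_ * _).
  by rewrite [RHS]fineK ?integrable_fin_num// [RHS]integralE.
move=> B mB; rewrite /mscale/= /mrestr.
have := full_cond_mul fc mB mA measurableT.
rewrite setIT => /(_ A0) h.
rewrite -(full_cond_setT fc (measurableI _ _ mB mA)) h.
rewrite -(full_cond_setT fc mA)/= -EFinM mulrCA mulVf ?mulr1//.
by rewrite -(full_cond_setT fc mA)/= in fPA0; rewrite gt_eqF.
Qed.

End conditioning.

(** * Products with a function of constant sign *)

Section conditional_sign.
Import HBNNSimple.
Local Open Scope ring_scope.
Context {d : measure_display} {T : measurableType d} {R : realType}.
Variable mu : {measure set T -> \bar R}.

(** The condition on the sets [g @^-1` B] says that the conditional expectation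
    of [Y] given [g] is nonpositive. *)
Lemma Rintegral_mul_le0 (D : set T) (g Y : T -> R) :
  measurable D -> measurable_fun [set: T] g -> (forall x, D x -> 0 <= g x) ->
  mu.-integrable D (EFin \o Y) ->
  mu.-integrable D (EFin \o (fun x => g x * Y x)) ->
  (forall B, measurable B -> \int[mu]_(x in D `&` g @^-1` B) Y x <= 0) ->
  \int[mu]_(x in D) (g x * Y x) <= 0.
Proof.
move=> mD mg g0 iY igY HB.
(* The simple functions approximate the positive part on the real line, and
   are then composed with [g]: their level sets are of the form [g @^-1` B]. *)
pose f : R -> \bar R := fun t => (Num.max 0 t)%:E.
have mf : measurable_fun [set: R] f.
  by apply/measurable_EFinP; exact: measurable_maxr.
have f0 t : [set: R] t -> (0 <= f t)%E by rewrite lee_fin le_max lexx.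
pose phi := nnsfun_approx measurableT mf.
have phile n x : D x -> phi n (g x) <= g x.
  move=> Dx; have := @le_approx _ _ R _ f n (g x) f0 Logic.I.
  by rewrite -(nnsfun_approxE measurableT mf) lee_fin /f max_r ?g0.
have mphig n : measurable_fun [set: T] (fun x => phi n (g x)).
  by apply: measurableT_comp.
have mY : measurable_fun D Y by apply/measurable_EFinP/(measurable_int mu).
have iphi n : mu.-integrable D (EFin \o (fun x => phi n (g x) * Y x)).
  apply: le_integrable igY => //.
    apply/measurable_EFinP/measurable_funM => //; exact: measurable_funTS.
  move=> x Dx /=; rewrite lee_fin !normrM ler_wpM2r//.
  by rewrite !ger0_norm ?phile ?g0.
have simple n : (\int[mu]_(x in D) (phi n (g x) * Y x)%:E <= 0)%E.
  under eq_integral.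
    move=> x xD; rewrite fimfunE fsbig_finite//= big_distrl/= -sumEFin; over.
  rewrite integral_sum//=; last first.
    move=> t; apply: (@le_integrable _ _ _ mu D mD _
      (EFin \o (fun x => t * Y x))) => //.
    - apply/measurable_EFinP/measurable_funM => //.
      apply/measurable_funM => //; apply: measurable_funTS.
      by apply: (measurableT_comp _ mg).
    - move=> x Dx /=; rewrite lee_fin !normrM ler_wpM2r//.
      by rewrite ler_piMr// indicE ger0_norm// lern1; case: (_ \in _).
    - exact: (integrableZl mD t iY).
  apply: sume_le0 => t _.
  have [t0|t0] := ltP t 0.
    rewrite integral0_eq// => x Dx; rewrite indicE memNset ?mulr0 ?mul0r//=.
    move=> tE; have : 0 <= phi n (g x) by exact: fun_ge0.
    by rewrite tE leNgt t0.
  have iYB : mu.-integrable (D `&` g @^-1` (phi n @^-1` [set t])) (EFin \o Y).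
    apply: integrableS iY => //; apply: measurableI => //.
    by rewrite -[X in measurable X]setTI; exact: mg.
  under eq_integral do rewrite -mulrA EFinM.
  rewrite integralZl//; last first.
    apply: (le_integrable mD _ _ iY) => //.
      apply/measurable_EFinP/measurable_funM => //; apply: measurable_funTS.
      by apply: (measurableT_comp _ mg).
    move=> x Dx /=; rewrite lee_fin normrM ler_piMl//.
    by rewrite indicE ger0_norm// lern1; case: (_ \in _).
  rewrite mule_ge0_le0//.
  have := HB _ (measurable_funPTI (phi n) (measurable_set1 t)).
  rewrite -lee_fin fineK; last first.
    by rewrite integrable_fin_num//; apply: measurableI => //;
      rewrite -[X in measurable X]setTI; exact: mg.
  rewrite integral_mkcondr; congr (_ <= _)%E.
  apply: eq_integral => x _; rewrite patchE indicE /=.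
  rewrite (_ : (x \in g @^-1` _) = (g x \in phi n @^-1` [set t])); last first.
    by apply/idP/idP; rewrite !inE.
  by case: ifP => _; rewrite ?mul1r ?mul0r.
have [] := @dominated_convergence _ _ _ mu D mD
  (fun n x => (phi n (g x) * Y x)%:E) (fun x => (g x * Y x)%:E)
  (fun x => `|(g x * Y x)%:E|%E).
- by move=> n; exact: (measurable_int mu (iphi n)).
- exact: (measurable_int mu igY).
- apply: aeW => x Dx; have fgx : f (g x) = (g x)%:E by rewrite /f max_r ?g0.
  rewrite EFinM -fgx.
  apply: (@cvgeZr _ _ _ (fun n => (phi n (g x))%:E) _ (Y x)%:E) => //.
  exact: (@cvg_nnsfun_approx _ _ _ _ measurableT _ mf f0 (g x) Logic.I).
- exact: integrable_abse.
- apply: aeW => x n Dx /=; rewrite lee_fin !normrM ler_wpM2r//.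
  by rewrite !ger0_norm ?phile ?g0.
move=> _ _ cvgI.
rewrite -lee_fin fineK; last exact: integrable_fin_num.
rewrite -(cvg_lim _ cvgI)//; apply: lime_le; last exact: nearW.
by apply/cvg_ex; eexists; exact: cvgI.
Qed.

End conditional_sign.

(** * Drift of the square in one step *)

Section drift.
Local Open Scope ring_scope.
Context {d : measure_display} {T : measurableType d} {R : realType}.
Variable P : probability T R.
Implicit Types (D J : set T) (V X f g : T -> R).

Lemma Lfun2_integrableM D f g : measurable D ->
  f \in Lfun P 2%:E -> g \in Lfun P 2%:E ->
  P.-integrable D (EFin \o (fun x => f x * g x)).
Proof.
move=> mD f2 g2; apply: (@integrableS _ _ _ _ setT) => //.
by apply/Lfun1_integrable; exact: Lfun2_mul_Lfun1.
Qed.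

Lemma Lfun2_integrable D f : measurable D -> f \in Lfun P 2%:E ->
  P.-integrable D (EFin \o f).
Proof.
move=> mD f2; apply: (@integrableS _ _ _ _ setT) => //.
apply/Lfun1_integrable; apply: Lfun_subset12 f2.
exact: fin_num_measure.
Qed.

Lemma sqr_integrable_Lfun2 f : measurable_fun [set: T] f ->
  P.-integrable setT (EFin \o (fun x => f x ^+ 2)) -> f \in Lfun P 2%:E.
Proof.
move=> mf /integrableP[_ ioo]; apply/andP; split; rewrite inE//=.
rewrite /finite_norm unlock /Lnorm poweR_lty//.
apply: le_lt_trans ioo; rewrite le_eqVlt; apply/orP; left; apply/eqP.
apply: eq_integral => x _ /=.
by rewrite powR_mulrn// normrX.
Qed.

Lemma Lfun2D f g : f \in Lfun P 2%:E -> g \in Lfun P 2%:E ->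
  (fun x => f x + g x) \in Lfun P 2%:E.
Proof. exact: (Lfun_addr_closed P (lee1n 2)).2. Qed.

Lemma Lfun2N f : f \in Lfun P 2%:E -> (fun x => - f x) \in Lfun P 2%:E.
Proof. exact: (@Lfun_oppr_closed _ _ _ P 2%:E f). Qed.

Lemma Lfun2Dcst f r : f \in Lfun P 2%:E -> (fun x => f x + r) \in Lfun P 2%:E.
Proof. by move=> f2; apply: Lfun2D => //; exact: Lfun_cst. Qed.

(** With a = u - m and b = m - l, (X - u)^2 is (X - m)^2 - 2a (X - m) + a^2, and
    the integral of X - m over D is at least - b P(D): the excess over
    (X - m)^2 is at most (2ab + a^2) P(D), hence at most (a + b)^2 P(D). *)
Lemma drift_sqr_le_pos D V X (l m u : R) : measurable D ->
  V \in Lfun P 2%:E -> X \in Lfun P 2%:E -> l <= m <= u ->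
  (forall x, D x -> 0 <= V x) ->
  (forall B, measurable B ->
    \int[P]_(x in D `&` V @^-1` B) X x <= u * fine (P (D `&` V @^-1` B))) ->
  l * fine (P D) <= \int[P]_(x in D) X x ->
  \int[P]_(x in D) (V x + X x - u) ^+ 2 <=
  \int[P]_(x in D) V x ^+ 2 +
  (\int[P]_(x in D) (X x - m) ^+ 2 + (u - l) ^+ 2 * fine (P D)).
Proof.
move=> mD V2 X2 /andP[lm mu] V0 HB Hl.
have mV : measurable_fun [set: T] V.
  by move: (sub_Lfun_mfun V2); rewrite inE.
have Xu2 : (fun x => X x - u) \in Lfun P 2%:E by exact: Lfun2Dcst.
have Xm2 : (fun x => X x - m) \in Lfun P 2%:E by exact: Lfun2Dcst.
have iX := Lfun2_integrable mD X2.
have icst r : P.-integrable D (EFin \o (fun=> r)).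
  by apply: Lfun2_integrable => //; exact: Lfun_cst.
have cross : \int[P]_(x in D) (V x * (X x - u)) <= 0.
  apply: Rintegral_mul_le0 => //.
  - exact: Lfun2_integrable.
  - exact: Lfun2_integrableM.
  move=> B mB; have mDB : measurable (D `&` V @^-1` B).
    by apply: measurableI => //; rewrite -[X in measurable X]setTI; exact: mV.
  rewrite RintegralB//; last 2 first.
  - exact: Lfun2_integrable.
  - by apply: Lfun2_integrable => //; exact: Lfun_cst.
  by rewrite Rintegral_cst// subr_le0; exact: HB.
have iV2 : P.-integrable D (EFin \o (fun x => V x ^+ 2)).
  by under eq_fun do rewrite expr2; exact: Lfun2_integrableM.
have iXm2 : P.-integrable D (EFin \o (fun x => (X x - m) ^+ 2)).
  by under eq_fun do rewrite expr2; exact: Lfun2_integrableM.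
have iVX : P.-integrable D (EFin \o (fun x => 2 * (V x * (X x - u)))).
  by apply: (integrableZl mD 2 (Lfun2_integrableM mD V2 Xu2)).
have icX : P.-integrable D (EFin \o (fun x => 2 * (u - m) * X x)).
  by apply: (integrableZl mD _ iX).
pose q := 2 * (u - m) * m + (u - m) ^+ 2.
have -> : \int[P]_(x in D) (V x + X x - u) ^+ 2 =
    \int[P]_(x in D) (V x ^+ 2 + (X x - m) ^+ 2 +
      (2 * (V x * (X x - u)) + (q - 2 * (u - m) * X x))).
  by apply: eq_Rintegral => x _; rewrite /q; ring.
rewrite RintegralD//; last 2 first.
- exact: (integrableD mD iV2 iXm2).
- exact: (integrableD mD iVX (integrableB mD (icst q) icX)).
rewrite RintegralD// RintegralD//; last first.
  exact: (integrableB mD (icst q) icX).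
rewrite RintegralB// Rintegral_cst//.
rewrite RintegralZl//; last exact: Lfun2_integrableM.
rewrite RintegralZl// /q.
have := fine_ge0 (measure_ge0 P D).
move: (fine _) Hl cross => p; move: (\int[P]_(x in D) X x) => e.
move: (\int[P]_(x in D) (V x * _)) => c.
move=> Hl cross p0; rewrite -!addrA lerD2l lerD2l.
have h1 : 0 <= (u - m) * (e - l * p) by rewrite mulr_ge0 ?subr_ge0.
have h2 : 0 <= (m - l) ^+ 2 * p by rewrite mulr_ge0 ?sqr_ge0.
nra.
Qed.

Lemma Lfun2_step V X (l u : R) : V \in Lfun P 2%:E -> X \in Lfun P 2%:E ->
  (fun x => V x + (X x - (if 0 < V x then u else l))) \in Lfun P 2%:E.
Proof.
move=> V2 X2.
have mV : measurable_fun [set: T] V.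
  by move: (sub_Lfun_mfun V2); rewrite inE.
apply: Lfun2D => //; apply: Lfun2D => //.
have mt : measurable_fun [set: T] (fun x => - (if 0 < V x then u else l)).
  apply: measurableT_comp => //; apply: measurable_fun_if => //.
  exact: measurable_fun_ltr.
apply: sqr_integrable_Lfun2 => //.
apply: (@le_integrable _ _ _ P setT measurableT _
  (EFin \o cst (u ^+ 2 + l ^+ 2))) => //.
- exact/measurable_EFinP/measurable_funX.
- move=> x _ /=; rewrite lee_fin !ger0_norm ?addr_ge0 ?sqr_ge0// sqrrN.
  by case: ifP => _; rewrite ?lerDl ?lerDr sqr_ge0.
- exact: finite_measure_integrable_cst.
Qed.

(** The part of [J] where [V] is positive is the previous lemma; the part where
    it is not reduces to it by changing the signs of [V], [X], [l], [m], [u]. *)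
Lemma drift_sqr_le J V X (l m u : R) : measurable J ->
  V \in Lfun P 2%:E -> X \in Lfun P 2%:E -> l <= m <= u ->
  (forall B, measurable B -> let A := J `&` V @^-1` B in
    l * fine (P A) <= \int[P]_(x in A) X x <= u * fine (P A)) ->
  \int[P]_(x in J) (V x + (X x - (if 0 < V x then u else l))) ^+ 2 <=
  \int[P]_(x in J) V x ^+ 2 +
  (\int[P]_x (X x - m) ^+ 2 + (u - l) ^+ 2).
Proof.
move=> mJ V2 X2 lmu HA.
have mV : measurable_fun [set: T] V.
  by move: (sub_Lfun_mfun V2); rewrite inE.
have mVB B : measurable B -> measurable (V @^-1` B).
  by move=> mB; rewrite -[X in measurable X]setTI; exact: mV.
pose I : set R := `]0, +oo[%classic.
have mI : measurable I by exact: measurable_itv.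
pose J1 := J `&` V @^-1` I; pose J2 := J `&` V @^-1` (~` I).
have mJ1 : measurable J1 by apply: measurableI => //; exact: mVB.
have mJ2 : measurable J2.
  by apply: measurableI => //; apply: mVB; exact: measurableC.
have V1 x : J1 x -> 0 < V x by move=> [_]; rewrite /I/= in_itv/= andbT.
have V0 x : J2 x -> V x <= 0.
  by move=> [_]; rewrite /I/= in_itv/= andbT => /negP; rewrite -leNgt.
have JE : J = J1 `|` J2.
  by rewrite /J1 /J2 -setIUr -preimage_setU setUv preimage_setT setIT.
have J12 : [disjoint J1 & J2].
  apply/disj_set2P; rewrite /J1 /J2 setIACA -preimage_setI.
  by rewrite setICr preimage_set0 setI0.
have Xm2 : (fun x => X x - m) \in Lfun P 2%:E by exact: Lfun2Dcst.
have isqr D f : measurable D -> f \in Lfun P 2%:E ->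
    P.-integrable D (EFin \o (fun x => f x ^+ 2)).
  by move=> mD f2; under eq_fun do rewrite expr2; exact: Lfun2_integrableM.
have le1 : \int[P]_(x in J1) (V x + (X x - (if 0 < V x then u else l))) ^+ 2 <=
  \int[P]_(x in J1) V x ^+ 2 +
  (\int[P]_(x in J1) (X x - m) ^+ 2 + (u - l) ^+ 2 * fine (P J1)).
  rewrite [leLHS](_ : _ = \int[P]_(x in J1) (V x + X x - u) ^+ 2); last first.
    by apply: eq_Rintegral => x /[!inE] /V1 ->; rewrite addrA.
  apply: drift_sqr_le_pos => //.
  - by move=> x /V1/ltW.
  - move=> B mB; rewrite -setIA -preimage_setI.
    by have /andP[] := HA _ (measurableI _ _ mI mB).
  - by have /andP[] := HA _ mI.
have le2 : \int[P]_(x in J2) (V x + (X x - (if 0 < V x then u else l))) ^+ 2 <=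
  \int[P]_(x in J2) V x ^+ 2 +
  (\int[P]_(x in J2) (X x - m) ^+ 2 + (u - l) ^+ 2 * fine (P J2)).
  rewrite [leLHS](_ : _ =
    \int[P]_(x in J2) ((- V x) + (- X x) - (- l)) ^+ 2); last first.
    apply: eq_Rintegral => x /[!inE] /V0; rewrite leNgt => /negbTE ->.
    by rewrite -sqrrN; congr (_ ^+ 2); ring.
  have -> : \int[P]_(x in J2) V x ^+ 2 = \int[P]_(x in J2) (- V x) ^+ 2.
    by apply: eq_Rintegral => x _; rewrite sqrrN.
  have -> : \int[P]_(x in J2) (X x - m) ^+ 2 =
            \int[P]_(x in J2) ((- X x) - (- m)) ^+ 2.
    by apply: eq_Rintegral => x _; rewrite -sqrrN; congr (_ ^+ 2); ring.
  have -> : u - l = (- l) - (- u) by ring.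
  have intN A : measurable A ->
      \int[P]_(x in A) (- X x) = - \int[P]_(x in A) X x.
    move=> mA; rewrite -mulN1r -RintegralZl//; last exact: Lfun2_integrable.
    by apply: eq_Rintegral => x _; rewrite mulN1r.
  apply: (@drift_sqr_le_pos J2 (fun x => - V x) (fun x => - X x)) => //.
  - exact: Lfun2N.
  - exact: Lfun2N.
  - by rewrite !lerN2 andbC.
  - by move=> x /V0; rewrite oppr_ge0.
  - move=> B mB.
    have mNB : measurable [set t : R | B (- t)].
      by rewrite -[X in measurable X]setTI; exact: (@oppr_measurable R setT).
    have -> : J2 `&` (fun x => - V x) @^-1` B =
        J `&` V @^-1` (~` I `&` [set t | B (- t)]).
      by rewrite preimage_setI setIA.
    have mC := measurableI _ _ (measurableC mI) mNB.
    rewrite intN; last by apply: measurableI => //; exact: mVB.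
    by rewrite mulNr lerN2; have /andP[] := HA _ mC.
  - rewrite intN// mulNr lerN2.
    by have /andP[] := HA _ (measurableC mI).
have mJU : measurable (J1 `|` J2) by rewrite -JE.
have W2 := Lfun2_step l u V2 X2.
rewrite {1 2}JE Rintegral_setU//; last exact: (isqr _ _ mJU W2).
rewrite [in leRHS]Rintegral_setU//; last exact: (isqr _ _ mJU V2).
apply: le_trans (lerD le1 le2) _.
have le3 : \int[P]_(x in J1) (X x - m) ^+ 2 + \int[P]_(x in J2) (X x - m) ^+ 2
    <= \int[P]_x (X x - m) ^+ 2.
  rewrite -Rintegral_setU//; last exact: (isqr _ _ mJU Xm2).
  rewrite -JE Rintegral_mkcond; apply: le_Rintegral => //.
  - rewrite -restrict_EFin; apply/(integrable_mkcond _ mJ).1.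
    exact: (isqr _ _ mJ Xm2).
  - exact: (isqr _ _ measurableT Xm2).
  - by move=> x _; rewrite patchE; case: ifP => // _; exact: sqr_ge0.
have le4 : fine (P J1) + fine (P J2) <= 1.
  rewrite -fineD ?fin_num_measure// -measureU//; last exact/disj_set2P.
  rewrite -JE -[leRHS]/(fine 1%E) fine_le ?fin_num_measure//.
  exact: probability_le1.
have := ler_wpM2l (sqr_ge0 (u - l)) le4.
rewrite mulrDr mulr1; lra.
Qed.

End drift.

(** * A maximal inequality for processes with bounded drift *)

Section maximal_inequality.
Local Open Scope ring_scope.
Context {d : measure_display} {T : measurableType d} {R : realType}.
Variables (P : probability T R) (W : nat -> T -> R) (C : R).

(** The square of eps k is the barrier for a process that is itself a square.
    The event is sure when [n < N], so that the bound on the drift over such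
    events includes a bound on the drift of the mean. *)
Definition below (eps : R) (N n : nat) : set T :=
  [set w | forall k, (N <= k <= n)%N -> W k w < (eps * k%:R) ^+ 2].

Hypothesis iW : forall n, P.-integrable setT (EFin \o W n).
Hypothesis W_ge0 : forall n w, 0 <= W n w.
Hypothesis W0 : forall w, W 0%N w = 0.
Hypothesis W_drift : forall eps N n,
  \int[P]_(w in below eps N n) W n.+1 w <=
  \int[P]_(w in below eps N n) W n w + C.

Let C_ge0 : 0 <= C.
Proof.
have := W_drift 0 1 0; have -> : below 0 1 0 = setT.
  by apply/seteqP; split => // w _ k /andP[k1 /(leq_trans k1)].
rewrite [X in _ <= X + _](_ : _ = 0); last first.
  by rewrite /Rintegral integral0_eq// => w _; rewrite W0.
by rewrite add0r; apply: le_trans; apply: Rintegral_ge0.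
Qed.

Let mW n : measurable_fun [set: T] (W n).
Proof. exact/measurable_EFinP/(measurable_int P (iW n)). Qed.

Let mlt n b : measurable [set w | W n w < b].
Proof.
rewrite (_ : [set w | _] = W n @^-1` `]-oo, b[%classic).
  by rewrite -[X in measurable X]setTI; apply: mW.
by apply/seteqP; split => w /=; rewrite in_itv.
Qed.

Let belowT eps N n : (n < N)%N -> below eps N n = setT.
Proof.
move=> nN; apply/seteqP; split => // w _ k /andP[Nk kn].
by have := leq_trans nN (leq_trans Nk kn); rewrite ltnn.
Qed.

Let belowS eps N n : (N <= n.+1)%N ->
  below eps N n.+1 =
  below eps N n `&` [set w | W n.+1 w < (eps * n.+1%:R) ^+ 2].
Proof.
move=> Nn; apply/seteqP; split => [w H|w [H1 H2] k].
  split => [k /andP[Nk kn]|]; apply: H; first by rewrite Nk ltnW.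
  by rewrite Nn leqnn.
move=> /andP[Nk]; rewrite leq_eqVlt ltnS => /predU1P[->//|kn].
by apply: H1; rewrite Nk.
Qed.

Lemma measurable_below eps N n : measurable (below eps N n).
Proof.
elim: n => [|n IH].
  case: N => [|N]; last by rewrite belowT.
  rewrite (_ : below _ _ _ = [set w | W 0%N w < (eps * 0%:R) ^+ 2])//.
  by apply/seteqP; split => [w /(_ 0%N)|w H k /[!leqn0] /eqP->//]; exact.
have [Nn|Nn] := leqP N n.+1; last by rewrite belowT.
by rewrite belowS//; exact: measurableI.
Qed.

Let expect_le n : \int[P]_w W n w <= n%:R * C.
Proof.
elim: n => [|n IH].
  by rewrite mul0r /Rintegral integral0_eq// => w _; rewrite W0.
have := W_drift 0 n.+1 n; rewrite belowT// => /le_trans; apply.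
by rewrite -natr1 mulrDl mul1r lerD2r.
Qed.

(** Markov's inequality on the part of [G] that leaves at time [n]. *)
Let stop_le G n b : measurable G ->
  \int[P]_(w in G `&` [set w | W n w < b]) W n w +
    b * fine (P (~` (G `&` [set w | W n w < b]))) <=
  \int[P]_(w in G) W n w + b * fine (P (~` G)).
Proof.
move=> mG; set Q := [set w | W n w < b]; have mQ : measurable Q by exact: mlt.
have mGQ : measurable (G `&` Q) by exact: measurableI.
have mGD : measurable (G `\` Q) by exact: measurableD.
have iG A : measurable A -> P.-integrable A (EFin \o W n).
  by move=> mA; exact: (@integrableS _ _ _ _ setT).
have GE : G = (G `&` Q) `|` (G `\` Q) by rewrite setUIDK.
have -> : \int[P]_(w in G) W n w =
    \int[P]_(w in G `&` Q) W n w + \int[P]_(w in G `\` Q) W n w.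
  rewrite {1}GE Rintegral_setU//; first by rewrite -GE; exact: iG.
  by apply/disj_set2P; rewrite setDE setIACA setICr setI0.
have -> : fine (P (~` (G `&` Q))) = fine (P (~` G)) + fine (P (G `\` Q)).
  rewrite -fineD ?fin_num_measure//; last exact: measurableC.
  rewrite -measureU//; last 2 first.
  - exact: measurableC.
  - by rewrite setDE setIA setICl set0I.
  congr (fine (P _)); apply/seteqP; split => w /=.
    by move=> /not_andP; have [Gw|] := pselect (G w); [case=> //; right|left].
  by case=> [nG [/nG]|[Gw nQ] [_ /nQ]].
have : b * fine (P (G `\` Q)) <= \int[P]_(w in G `\` Q) W n w.
  rewrite -Rintegral_cst//; apply: le_Rintegral => //.
  - exact: finite_measure_integrable_cst.
  - exact: iG.
  - by move=> w [_ /negP]; rewrite -leNgt.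
lra.
Qed.

(** The mass of the surviving part of [W n / n ^+ 2] is carried along: when [n]
    increases, it pays for the paths that cross the barrier and gains at most
    C/n^2 <= C/(n-1) - C/n, which telescopes. *)
Let maximal_bound eps N m : (0 < N)%N ->
  \int[P]_(w in below eps N (N + m)) W (N + m)%N w / (N + m)%:R ^+ 2 +
    eps ^+ 2 * fine (P (~` below eps N (N + m))) <=
  C * (2 / N%:R - 1 / (N + m)%:R).
Proof.
move=> N0; elim: m => [|m].
  rewrite addn0; have N0R : 0 < N%:R :> R by rewrite ltr0n.
  case: N N0 N0R => // N _ N0R.
  have := stop_le N.+1 ((eps * N.+1%:R) ^+ 2) measurableT.
  rewrite -(@belowT eps N.+1 N)// -belowS// (belowT _ (ltnSn N)) setCT measure0.
  rewrite mulr0 addr0 => /le_trans/(_ (expect_le _)).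
  move: (fine _) (\int[P]_(_ in _) _) N0R => p i; move: (N.+1%:R) => x x0 H.
  have -> : C * (2 / x - 1 / x) = (x * C) / x ^+ 2 by field; rewrite gt_eqF.
  have -> : i / x ^+ 2 + eps ^+ 2 * p = (i + (eps * x) ^+ 2 * p) / x ^+ 2.
    by field; rewrite gt_eqF.
  by rewrite ler_pM2r// invr_gt0 exprn_gt0.
rewrite addnS; set n := (N + m)%N.
have n0 : 0 < n%:R :> R by rewrite ltr0n addn_gt0 N0.
have Nn : (N <= n.+1)%N by rewrite /n -addnS leq_addr.
have := stop_le n.+1 ((eps * n.+1%:R) ^+ 2) (measurable_below eps N n).
rewrite -belowS//; have := W_drift eps N n.
have : 0 <= \int[P]_(w in below eps N n) W n w by apply: Rintegral_ge0.
move: (\int[P]_(w in below eps N n) W n w) => i.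
move: (\int[P]_(w in below eps N n) W n.+1 w) => i'.
move: (\int[P]_(w in below eps N n.+1) W n.+1 w) => j.
move: (fine (P (~` below eps N n))) (fine (P (~` below eps N n.+1))) => q p.
move=> i0 H1 H2.
rewrite -natr1 in H2 *; move: (n%:R) n0 H2 => x x0 H2 IH.
have x1 : 0 < x + 1 by rewrite addr_gt0.
have xn0 : x != 0 by rewrite gt_eqF.
have x1n0 : x + 1 != 0 by rewrite gt_eqF.
have H3 : p * eps ^+ 2 + j / (x + 1) ^+ 2 <=
    q * eps ^+ 2 + (i + C) / (x + 1) ^+ 2.
  rewrite -(ler_pM2r (exprn_gt0 2 x1)) !mulrDl !divfK ?expf_neq0//.
  lra.
have H4 : i / (x + 1) ^+ 2 <= i / x ^+ 2.
  rewrite ler_wpM2l// lef_pV2 ?posrE ?exprn_gt0//.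
  by rewrite lerXn2r ?nnegrE ?ltW// ltrDl.
have H5 : C / (x + 1) ^+ 2 <= C * (1 / x - 1 / (x + 1)).
  rewrite ler_wpM2l//.
  have -> : 1 / x - 1 / (x + 1) = (x * (x + 1))^-1.
    by field; rewrite xn0 x1n0.
  rewrite lef_pV2 ?posrE ?exprn_gt0 ?mulr_gt0// expr2 ler_pM2r//.
  by rewrite lerDl.
rewrite mulrDl in H3.
rewrite !(mulrBr C) in H5 IH *; lra.
Qed.

(** Since [2 / N%:R] does not involve [m], the bound is uniform in the length of
    the time window. *)
Lemma maximal_inequality eps N m : 0 < eps -> (0 < N)%N ->
  fine (P (~` below eps N (N + m))) <=
  C * (2 / N%:R - 1 / (N + m)%:R) / eps ^+ 2.
Proof.
move=> e0 N0; rewrite ler_pdivlMr ?exprn_gt0// mulrC.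
apply: le_trans (maximal_bound eps m N0) => /=.
by rewrite lerDr mulr_ge0 ?Rintegral_ge0// invr_ge0 exprn_ge0.
Qed.

Lemma ae_eventually_below eps : 0 < eps ->
  {ae P, forall w, exists N, forall n, (N <= n)%N ->
    W n w < (eps * n%:R) ^+ 2}.
Proof.
move=> e0; pose U N := \bigcup_m ~` below eps N (N + m).
have mU N : measurable (U N).
  by apply: bigcupT_measurable => m; apply/measurableC/measurable_below.
have PU N : (0 < N)%N -> (P (U N) <= (C * 2 / eps ^+ 2 / N%:R)%:E)%E.
  move=> N0.
  have cv : P (~` below eps N (N + m)) @[m --> \oo] --> P (U N).
    apply: nondecreasing_cvg_mu; [|exact: mU|].
    - by move=> m; apply/measurableC/measurable_below.
    - move=> m m' mm'; apply/subsetPset/subsetC => w H k /andP[Nk km].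
      by apply: H; rewrite Nk (leq_trans km)// leq_add2l.
  rewrite -(cvg_lim _ cv)//; apply: lime_le.
    by apply/cvg_ex; eexists; exact: cv.
  apply: nearW => m; rewrite -[leLHS]fineK ?fin_num_measure//; last first.
    exact/measurableC/measurable_below.
  rewrite lee_fin; apply: le_trans (maximal_inequality m e0 N0) _.
  rewrite [leRHS]mulrAC ler_pM2r ?invr_gt0 ?exprn_gt0//.
  rewrite -mulrA ler_wpM2l// lerBlDr lerDl divr_ge0//.
exists (\bigcap_N U N.+1); split.
- exact: bigcapT_measurable.
- have PN N : (P (\bigcap_N U N.+1) <= (C * 2 / eps ^+ 2 / N.+1%:R)%:E)%E.
    apply: le_trans (PU _ (ltn0Sn N)); apply: le_measure; rewrite ?inE//.
      exact: bigcapT_measurable.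
    by move=> w; exact.
  apply/eqP; rewrite eq_le measure_ge0 andbT.
  have c0 : (C * 2 / eps ^+ 2 * N.+1%:R^-1)%:E @[N --> \oo] -->
      (C * 2 / eps ^+ 2 * 0)%:E.
    by apply: cvg_EFin; [exact: nearW|apply: cvgMr; exact: cvg_harmonic].
  rewrite mulr0 in c0; rewrite -[leRHS](cvg_lim _ c0)//.
  apply: lime_ge; first by apply/cvg_ex; eexists; exact: c0.
  exact: nearW.
- move=> w /= H N _; apply: contrapT => nU; apply: H; exists N.+1 => n Nn.
  apply: contrapT => nW; apply: nU; exists (n - N.+1)%N => //=.
  by rewrite subnKC// => /(_ n); rewrite Nn leqnn => /(_ isT).
Qed.

End maximal_inequality.

(** * Events of the past and the excess process *)

Section past_events.
Local Open Scope ring_scope.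
Context {d : measure_display} {T : measurableType d} {R : realType}.
Implicit Types (X : nat -> T -> R) (A : set T) (l u : nat -> R) (w : T).

(** Invariance under a change of outcome that keeps the past values is easier to
    check than exhibiting a set of row vectors. *)
Lemma past_eventP X n A : measurable A ->
  (forall w w', (forall j, (j < n)%N -> X j w = X j w') -> A w -> A w') ->
  past_event X n A.
Proof.
move=> mA HA; split => //.
exists [set v | exists2 w, A w & v = \row_(j < n) X j w].
apply/seteqP; split => [w Aw|w [w' Aw' /rowP E]]; first by exists w.
by apply: HA Aw' => j jn; have := E (Ordinal jn); rewrite !mxE => /= ->.
Qed.

(** Of the two ends of the interval from [l k] to [u k], the one subtracted
    makes the next increment point towards 0 in conditional mean. This keeps
    the mean of the square linear in [n], at the cost of a total correction
    between the sums of the [l k] and of the [u k]. *)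
Fixpoint excess X (l u : nat -> R) n (w : T) : R :=
  if n is k.+1 then
    let v := excess X l u k w in v + (X k w - (if 0 < v then u k else l k))
  else 0.

Lemma excess_past X l u n w w' :
  (forall j, (j < n)%N -> X j w = X j w') ->
  excess X l u n w = excess X l u n w'.
Proof.
elim: n => //= n IH H; rewrite H// IH// => j jn.
by apply: H; exact: leqW.
Qed.

Lemma sum_sub_excess X l u n w : (forall i, l i <= u i) ->
  \sum_(i < n) l i <= \sum_(i < n) X i w - excess X l u n w <=
  \sum_(i < n) u i.
Proof.
move=> lu; elim: n => [|n /andP[IH1 IH2]]; first last.
  rewrite !big_ord_recr/=; have := lu n; case: ifP => _; lra.
by rewrite !big_ord0 subrr lexx.
Qed.

End past_events.

(** * Bounds on conditional means from weak irrelevance *)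

Section conditional_bounds.
Context {d : measure_display} {T : measurableType d} {R : realType}.
Variable K : set (probability T R).
Implicit Types (P : probability T R) (X : nat -> T -> R) (A : set T).

Lemma lowerE_le P (X : T -> R) : K P -> lowerE K X <= 'E_P[X].
Proof. by move=> KP; apply: ereal_inf_lbound; exists P. Qed.

Lemma upperE_ge P (X : T -> R) : K P -> 'E_P[X] <= upperE K X.
Proof. by move=> KP; apply: ereal_sup_ubound; exists P. Qed.

(** An expectation between two finite bounds is finite, and a finite integral is
    the integral of an integrable function. *)
Lemma lower_upper_integrable P (X : T -> R) : K P ->
  measurable_fun [set: T] X ->
  lowerE K X \is a fin_num -> upperE K X \is a fin_num ->
  P.-integrable setT (EFin \o X).
Proof.
move=> KP mX fl fu.
have : 'E_P[X] \is a fin_num.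
  rewrite fin_numElt (lt_le_trans _ (lowerE_le X KP)) ?ltNye_eq ?fl//=.
  by rewrite (le_lt_trans (upperE_ge X KP))// ltey_eq fu.
rewrite unlock -integral_fin_num_abs// => h.
by apply/integrableP; split => //; exact/measurable_EFinP.
Qed.

Lemma weak_irrelevance_condE c X i A P :
  weak_irrelevance K c X i.+2 -> K P ->
  P.-integrable setT (EFin \o X i.+1) ->
  past_event X i.+1 A -> 0 < P A ->
  lowerE K (X i.+1) <= condE P (X i.+1) A <= upperE K (X i.+1).
Proof.
move=> WI KP iX pA PA0; have mA := pA.1.
case: WI => [[fc WI]|WI].
  have A0 : A !=set0.
    by apply/set0P; apply: contraTneq PA0 => ->; rewrite measure0 ltxx.
  have [<- <-] := WI i.+1 A (ltnSn i.+1) pA A0.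
  rewrite -(full_condE_pos (fc P KP))//; apply/andP; split.
    by apply: ereal_inf_lbound; exists P.
  by apply: ereal_sup_ubound; exists P.
have uPA : 0 < upperP K A.
  by apply: lt_le_trans PA0 _; apply: ereal_sup_ubound; exists P.
have [<- <-] := WI i.+1 A (ltnSn i.+1) pA uPA.
by apply/andP; split;
  [apply: ereal_inf_lbound|apply: ereal_sup_ubound]; exists P.
Qed.

Lemma past_event0 X A : past_event X 0 A -> A = set0 \/ A = setT.
Proof.
move=> [_ [S AE]]; have [S0|S0] := pselect (S 0%R).
  right; rewrite AE; apply/seteqP; split => // w _ /=.
  by rewrite (_ : \row_j _ = 0%R)//; apply/rowP => -[].
left; rewrite AE; apply/seteqP; split => // w /=.
by rewrite (_ : \row_j _ = 0%R)//; apply/rowP => -[].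
Qed.

(** The conditional mean of [X i] is the integral over [A] divided by [P A] when
    [P A] is positive; when [P A] is 0 all three terms vanish, and for [i = 0]
    the past is trivial. *)
Lemma past_integral_bounds c X i A P :
  weak_irrelevance K c X i.+1 -> K P -> measurable_fun [set: T] (X i) ->
  lowerE K (X i) \is a fin_num -> upperE K (X i) \is a fin_num ->
  past_event X i A ->
  (fine (lowerE K (X i)) * fine (P A) <= \int[P]_(x in A) X i x <=
   fine (upperE K (X i)) * fine (P A))%R.
Proof.
move=> WI KP mX fl fu pA; have mA := pA.1.
have iX := lower_upper_integrable KP mX fl fu.
have [PA0|PA0] := eqVneq (P A) 0.
  rewrite PA0 !mulr0 /Rintegral null_set_integral ?lexx//.
  by apply/measurable_EFinP; exact: measurable_funTS.
case: i => [|i] in WI mX fl fu pA iX *.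
  case: (past_event0 pA) => AE; first by rewrite AE measure0 eqxx in PA0.
  rewrite AE probability_setT/= !mulr1 -!lee_fin !fineK//; last first.
    exact: integrable_fin_num.
  rewrite (_ : \int[P]_x (X 0%N x)%:E = 'E_P[X 0%N])%E; last by rewrite unlock.
  by rewrite lowerE_le// upperE_ge.
have {}PA0 : 0 < P A by rewrite lt0e PA0 measure_ge0.
have fPA0 : (0 < fine (P A))%R.
  by rewrite fine_gt0// PA0 ltey_eq fin_num_measure.
have := weak_irrelevance_condE WI KP iX pA PA0.
rewrite condE_integrable//.
rewrite -[X in X <= _ <= _]fineK// -[X in _ <= _ <= X]fineK// !lee_fin.
by rewrite ler_pdivlMr// ler_pdivrMr.
Qed.

Lemma variance_le_Lfun2 P (X : T -> R) (s : R) :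
  measurable_fun [set: T] X -> 'V_P[X] <= s%:E ->
  X \in Lfun P 2%:E /\
  (\int[P]_x (X x - fine 'E_P[X]) ^+ 2 <= s)%R.
Proof.
move=> mX; rewrite /variance covariance.unlock expectation.unlock => Vs.
move: Vs; set m := fine _ => Vs.
have E : \int[P]_w (((X \- cst m) * (X \- cst m))%R w)%:E =
    \int[P]_w ((X w - m) ^+ 2)%:E.
  by apply: eq_integral => w _; rewrite expr2.
rewrite E in Vs.
have mXm : measurable_fun [set: T] (fun w => X w - m)%R.
  exact: measurable_funB.
have V0 : 0 <= \int[P]_w ((X w - m) ^+ 2)%:E.
  by apply: integral_ge0 => w _; rewrite lee_fin sqr_ge0.
split.
  have -> : X = (fun w => (X w - m) + m)%R by apply/funext => w; rewrite subrK.
  apply: Lfun2Dcst; apply: sqr_integrable_Lfun2 => //.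
  apply/integrableP; split; first exact/measurable_EFinP/measurable_funX.
  under eq_integral do rewrite /= ger0_norm ?sqr_ge0//.
  by apply: le_lt_trans Vs _; rewrite ltry.
rewrite -lee_fin fineK// ge0_fin_numE//.
by apply: le_lt_trans Vs _; rewrite ltry.
Qed.

End conditional_bounds.

(** * The band around the means of the lower and upper expectations *)

Section band.
Local Open Scope ring_scope.
Context {d : measure_display} {T : measurableType d} {R : realType}.
Variables (K : set (probability T R)).
Variables (c : probability T R -> set T -> set T -> R).
Variables (X : nat -> {mfun T >-> R}) (delta sigma : R).
Hypothesis WI : forall n, weak_irrelevance K c X n.
Hypothesis fl : forall i, lowerE K (X i) \is a fin_num.
Hypothesis fu : forall i, upperE K (X i) \is a fin_num.
Hypothesis ldelta : forall i, (upperE K (X i) - lowerE K (X i) <= delta%:E)%E.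
Hypothesis lsigma :
  forall P, K P -> forall i, ('V_P[X i] <= (sigma ^+ 2)%:E)%E.
Variable P : probability T R.
Hypothesis KP : K P.

Let l i := fine (lowerE K (X i)).
Let u i := fine (upperE K (X i)).
Let C := sigma ^+ 2 + delta ^+ 2.
Let V := excess X l u.

Let m i := fine 'E_P[X i]%E.

Let lmu i : l i <= m i <= u i.
Proof.
have iX := lower_upper_integrable KP (measurable_funPT (X i)) (fl i) (fu i).
have fE : 'E_P[X i]%E \is a fin_num by rewrite unlock integrable_fin_num.
by rewrite /l /m /u !fine_le// ?lowerE_le ?upperE_ge.
Qed.

Let lu i : l i <= u i.
Proof. by have /andP[/le_trans h /h] := lmu i. Qed.

Let X2 i : (X i : T -> R) \in Lfun P 2%:E.
Proof. by case: (variance_le_Lfun2 (measurable_funPT (X i)) (lsigma KP i)). Qed.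

Let V2 n : V n \in Lfun P 2%:E.
Proof.
elim: n => [|n IH]; first exact: Lfun_cst.
exact: (Lfun2_step (l n) (u n) IH (X2 n)).
Qed.

Let W n w := V n w ^+ 2.

Let mV n : measurable_fun [set: T] (V n).
Proof. by move: (sub_Lfun_mfun (V2 n)); rewrite inE. Qed.

Let iW n : P.-integrable setT (EFin \o W n).
Proof. exact: Lfun2_integrableM measurableT (V2 n) (V2 n). Qed.

Let W_ge0 n w : 0 <= W n w. Proof. exact: sqr_ge0. Qed.

Let W0 w : W 0%N w = 0. Proof. exact: expr0n. Qed.

Let W_drift eps N n :
  \int[P]_(w in below W eps N n) W n.+1 w <=
  \int[P]_(w in below W eps N n) W n w + C.
Proof.
have mJ := measurable_below iW eps N n.
apply: le_trans (drift_sqr_le mJ (V2 n) (X2 n) (lmu n) _) _.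
  move=> B mB /=; apply: (past_integral_bounds (WI n.+1) KP _ (fl n) (fu n)).
    exact: measurable_funPT.
  apply: past_eventP.
    by apply: measurableI => //; rewrite -[X in measurable X]setTI; exact: mV.
  move=> w w' ww' [Jw Bw]; have VE k : (k <= n)%N -> V k w = V k w'.
    by move=> kn; apply: excess_past => j jk; apply: ww'; exact: leq_trans kn.
  split; last by rewrite /preimage/= -VE.
  move=> k /andP[Nk kn]; rewrite /W -VE//.
  by apply: Jw; rewrite Nk.
rewrite lerD2l /C lerD//.
  by case: (variance_le_Lfun2 (measurable_funPT (X n)) (lsigma KP n)).
have h : u n - l n <= delta.
  by rewrite -lee_fin EFinB !fineK//; exact: ldelta.
have h0 : 0 <= u n - l n by rewrite subr_ge0.
by rewrite lerXn2r ?nnegrE// (le_trans h0).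
Qed.

Definition within_band (eps : R) (n : nat) (w : T) :=
  (mean_lowerE K X n - eps < sample_mean X n w < mean_upperE K X n + eps)%R.

Let mean_excess n w : (0 < n)%N ->
  mean_lowerE K X n + V n w / n%:R <= sample_mean X n w <=
  mean_upperE K X n + V n w / n%:R.
Proof.
move=> n0; rewrite /mean_lowerE /mean_upperE /sample_mean -!mulrDl.
have := sum_sub_excess X n w lu.
rewrite !ler_pM2r ?invr_gt0 ?ltr0n// -/V => /andP[h1 h2].
by apply/andP; split; [rewrite -lerBrDr|rewrite -lerBlDr].
Qed.

Let lt_sqr_norm eps n w : 0 < eps -> (0 < n)%N ->
  (W n w < (eps * n%:R) ^+ 2) = (`|V n w / n%:R| < eps).
Proof.
move=> e0 n0; have n0R : 0 < n%:R :> R by rewrite ltr0n.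
rewrite /W -[in LHS]real_normK ?num_real// ltr_pXn2r;
  rewrite ?nnegrE ?mulr_ge0 ?(ltW e0)//.
by rewrite normrM [`|_^-1|]gtr0_norm ?invr_gt0// ltr_pdivrMr.
Qed.

Lemma measurable_sample_mean n : measurable_fun [set: T] (sample_mean X n).
Proof.
apply: measurable_funM => //.
by apply: measurable_sum => i; exact: measurable_funPT.
Qed.

Lemma measurable_within_band eps N N' :
  measurable [set w | forall n, (N <= n <= N')%N -> within_band eps n w].
Proof.
rewrite (_ : [set w | _] = \bigcap_(n in [set n | (N <= n <= N')%N])
    (sample_mean X n @^-1`
      `]mean_lowerE K X n - eps, mean_upperE K X n + eps[%classic)); last first.
  apply/seteqP; split => w H n /H; rewrite /within_band /= in_itv//.
apply: bigcap_measurableType => n _; rewrite -[X in measurable X]setTI.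
exact: measurable_sample_mean.
Qed.

Lemma band_probability eps N k : 0 < eps -> (0 < N)%N ->
  ((1 - C * (2 / N%:R - 1 / (N + k)%:R) / eps ^+ 2)%:E <=
  P [set w | forall n, (N <= n <= N + k)%N -> within_band eps n w])%E.
Proof.
move=> e0 N0; have mB := measurable_below iW eps N (N + k).
apply: (@le_trans _ _ (P (below W eps N (N + k)))).
  have := maximal_inequality iW W_ge0 W0 W_drift k e0 N0.
  rewrite probability_setC// fineB ?fin_num_measure//= => h.
  rewrite -[leRHS]fineK ?fin_num_measure// lee_fin; lra.
apply: le_measure; rewrite ?inE//; first exact: measurable_within_band.
move=> w H n Nn; have n0 : (0 < n)%N.
  by apply: leq_trans N0 _; case/andP: Nn.
have := H _ Nn; rewrite lt_sqr_norm// ltr_norml => /andP[h1 h2].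
have /andP[h3 h4] := mean_excess w n0.
by rewrite /within_band; apply/andP; split; lra.
Qed.

Lemma ae_excess_lt : {ae P, forall w, forall e : R, 0 < e ->
  \forall n \near \oo, `|V n w / n%:R| < e}.
Proof.
have H j : {ae P, forall w, exists N, forall n, (N <= n)%N ->
    W n w < (j.+1%:R^-1 * n%:R) ^+ 2}.
  by apply: (ae_eventually_below iW W_ge0 W0 W_drift); rewrite invr_gt0.
apply: filterS (ae_foralln H) => w Hw e e0.
have [j _ /(_ j (leqnn j))/= je] := near_infty_natSinv_lt (PosNum e0).
have [N HN] := Hw j; exists (maxn N 1) => // n /=.
rewrite geq_max => /andP[Nn n0]; apply: lt_trans je.
by rewrite -lt_sqr_norm ?invr_gt0//; exact: HN.
Qed.

Let limn_esup_le0 (v : nat -> \bar R) :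
  (forall e : R, 0 < e -> \forall n \near \oo, (v n <= e%:E)%E) ->
  (limn_esup v <= 0)%E.
Proof.
move=> Hv; apply/lee_addgt0Pr => e e0; rewrite add0e limn_esup_lim.
have [N _ HN] := Hv e e0.
apply: lime_le; first exact: is_cvg_esups.
exists N => // n /= Nn; apply: ge_ereal_sup => _ [k /= nk <-].
by apply: HN => /=; exact: leq_trans nk.
Qed.

Let probability1 (A : set T) :
  measurable A -> {ae P, forall w, A w} -> P A = 1%E.
Proof.
move=> mA hA; have mAC := measurableC mA.
have : P (~` A) = 0%E by apply/(negligibleP P mAC).
rewrite probability_setC// => /eqP; rewrite sube_eq ?add0e//.
by move=> /eqP.
Qed.

Lemma limsup_probability1 : P [set w | (limn_esup
  (fun n => (sample_mean X n w - mean_upperE K X n)%:E) <= 0)%E] = 1%E.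
Proof.
apply: probability1.
  rewrite -[X in measurable X]setTI; apply: emeasurable_fun_infty_c => //.
  apply: measurable_fun_limn_esup => n; apply/measurable_EFinP.
  by apply: measurable_funB => //; exact: measurable_sample_mean.
apply: filterS ae_excess_lt => w Hw; apply: limn_esup_le0 => e e0.
have [N _ HN] := Hw e e0; exists (maxn N 1) => // n /=.
rewrite geq_max => /andP[Nn n0]; rewrite lee_fin.
have := HN n Nn; rewrite ltr_norml => /andP[_ h].
by have /andP[_] := mean_excess w n0; lra.
Qed.

Lemma liminf_probability1 : P [set w | (0 <= limn_einf
  (fun n => (sample_mean X n w - mean_lowerE K X n)%:E))%E] = 1%E.
Proof.
pose v n w : \bar R := (mean_lowerE K X n - sample_mean X n w)%:E.
have vE w : limn_einf (fun n => (sample_mean X n w - mean_lowerE K X n)%:E) =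
    (- limn_esup (v ^~ w))%E.
  rewrite /limn_einf; congr (- limn_esup _)%E.
  by apply/funext => n; rewrite /v -EFinN opprB.
apply: probability1.
  rewrite (_ : [set w | _] = [set w | (limn_esup (v ^~ w) <= 0)%E]); last first.
    by apply/seteqP; split => w /=; rewrite vE oppe_ge0.
  rewrite -[X in measurable X]setTI; apply: emeasurable_fun_infty_c => //.
  apply: measurable_fun_limn_esup => n; apply/measurable_EFinP.
  by apply: measurable_funB => //; exact: measurable_sample_mean.
apply: filterS ae_excess_lt => w Hw; rewrite /= vE oppe_ge0.
apply: limn_esup_le0 => e e0.
have [N _ HN] := Hw e e0; exists (maxn N 1) => // n /=.
rewrite geq_max => /andP[Nn n0]; rewrite lee_fin.
have := HN n Nn; rewrite ltr_norml => /andP[h _].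
by have /andP[+ _] := mean_excess w n0; lra.
Qed.

End band.

(** * The law of large numbers *)

Theorem theorem4 (d : measure_display) (T : measurableType d) (R : realType)
    (K : set (probability T R)) (c : probability T R -> set T -> set T -> R)
    (X : nat -> {mfun T >-> R}) (delta sigma : R) :
  K !=set0 ->
  (forall n, weak_irrelevance K c X n) ->
  (forall i, lowerE K (X i) \is a fin_num) ->
  (forall i, upperE K (X i) \is a fin_num) ->
  (forall i, upperE K (X i) - lowerE K (X i) <= delta%:E) ->
  (forall P, K P -> forall i, 'V_P[X i] <= (sigma ^+ 2)%:E) ->
  let in_band (eps : R) (n : nat) (w : T) :=
    (mean_lowerE K X n - eps < sample_mean X n w < mean_upperE K X n + eps)%R in
  [/\ (forall (eps : R) (n : nat), (0 < eps)%R -> (0 < n)%N ->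
        (1 - (sigma ^+ 2 + delta ^+ 2) / (eps ^+ 2 * n%:R))%:E
          <= lowerP K [set w | in_band eps n w]),
      (forall eps : R, (0 < eps)%R ->
        exists2 N : nat, (0 < N)%N &
          forall N' : nat, (0 < N')%N ->
            (1 - 2 * eps)%:E <
            lowerP K [set w | forall n : nat, (N <= n <= N + N')%N ->
                                in_band eps n w]),
      (forall eps : R, (0 < eps)%R ->
        lowerP K [set w | in_band eps n w] @[n --> \oo] --> 1),
      lowerP K [set w | limn_esup
        (fun n => (sample_mean X n w - mean_upperE K X n)%:E) <= 0] = 1 &
      lowerP K [set w | 0 <= limn_einf
        (fun n => (sample_mean X n w - mean_lowerE K X n)%:E)] = 1].
Proof.
move=> [P0 KP0] WI fl fu ldelta lsigma in_band.
pose C := (sigma ^+ 2 + delta ^+ 2)%R.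
have C0 : (0 <= C)%R by rewrite addr_ge0 ?sqr_ge0.
have bandE eps n : [set w | in_band eps n w] =
    [set w | forall k, (n <= k <= n)%N -> in_band eps k w].
  apply/seteqP; split => [w H k|w H]; last by apply: H; rewrite leqnn.
  by rewrite -eqn_leq => /eqP <-.
have band_le eps N k : (0 < eps)%R -> (0 < N)%N ->
    (1 - C * (2 / N%:R - 1 / (N + k)%:R) / eps ^+ 2)%:E <=
    lowerP K [set w | forall n, (N <= n <= N + k)%N -> in_band eps n w].
  move=> e0 N0; apply: le_ereal_inf_tmp => _ [P KP <-].
  exact: (band_probability WI fl fu ldelta lsigma KP).
have one_le eps n : (0 < eps)%R -> (0 < n)%N ->
    (1 - C / (eps ^+ 2 * n%:R))%:E <= lowerP K [set w | in_band eps n w].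
  move=> e0 n0; have := band_le eps n 0%N e0 n0; rewrite addn0.
  have -> : (C * (2 / n%:R - 1 / n%:R) / eps ^+ 2 = C / (eps ^+ 2 * n%:R))%R.
    by field; rewrite !gt_eqF ?ltr0n.
  by rewrite bandE.
have lower1 (A : set T) : (forall P, K P -> P A = 1) -> lowerP K A = 1.
  move=> PA; rewrite /lowerP (_ : [set P A | P in K] = [set 1]) ?ereal_inf1//.
  apply/seteqP; split => [_ [P /PA -> <-]//|_ ->].
  by exists P0 => //; exact: PA.
split.
- exact: one_le.
(* N > C / eps^3 makes 2 C / (N eps^2) smaller than 2 eps. *)
- move=> eps e0; pose N := (Num.truncn (C / eps ^+ 3)).+1.
  exists N => // N' _; apply: lt_le_trans (band_le eps N N' e0 isT).
  have hN : (C / eps ^+ 3 < N%:R)%R by exact: truncnS_gt.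
  have N0 : (0 < N%:R :> R)%R by rewrite ltr0n.
  have NN0 : (0 < (N + N')%:R :> R)%R by rewrite ltr0n addSn.
  rewrite lte_fin ltrD2l ltrN2 ltr_pdivrMr ?exprn_gt0//.
  apply: (@le_lt_trans _ _ (C * (2 / N%:R))%R).
    by rewrite ler_wpM2l// gerBl divr_ge0 ?ltW.
  rewrite mulrCA -mulrA ltr_pM2l// ltr_pdivrMr//.
  move: hN; rewrite ltr_pdivrMr ?exprn_gt0// => /lt_le_trans; apply.
  by rewrite [leRHS]mulrC exprS.
- move=> eps e0.
  apply: (@squeeze_cvge _ _ _ _
    (fun n => (1 - C / (eps ^+ 2 * n%:R))%:E) _ (cst 1)).
  + exists 1%N => // n /= n0; rewrite one_le//=.
    apply: (@le_trans _ _ (P0 [set w | in_band eps n w])).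
      by apply: ereal_inf_lbound; exists P0.
    by apply: probability_le1; rewrite bandE; exact: measurable_within_band.
  + apply: cvg_EFin; first exact: nearW.
    rewrite -[X in _ --> X]subr0; apply: cvgB; first exact: cvg_cst.
    rewrite -(mulr0 (C / eps ^+ 2)%R).
    under eq_cvg do rewrite invfM mulrA.
    by apply: cvgMr; rewrite -cvg_shiftS; exact: cvg_harmonic.
  + exact: cvg_cst.
- apply: lower1 => P KP.
  exact: (limsup_probability1 WI fl fu ldelta lsigma KP).
- apply: lower1 => P KP.
  exact: (liminf_probability1 WI fl fu ldelta lsigma KP).
Qed.
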